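(* Let $H_1$ and $H_2$ be selfadjoint relations in $\mathbb C^n$ and assume that $H_1\le H_2$. Let $\mathsf i_j^-$ be the number of negative eigenvalues of $H_j$ (counted with multiplicity) and let $\mathsf i_j^0=\dim\ker H_j$, $j=1,2$. Then $$-H_1^{-1}\le -H_2^{-1}\quad\text{if and only if}\quad \mathsf i_1^-+\mathsf i_1^0=\mathsf i_2^-+\mathsf i_2^0 .$$
   Context: A (linear) relation $H$ in $\mathfrak H=\mathbb C^n$ is a linear subspace of $\mathfrak H\times\mathfrak H$. Put $\operatorname{dom}H=\{h:\{h,k\}\in H\}$, $\ker H=\{h:\{h,0\}\in H\}$, $\operatorname{mul}H=\{k:\{0,k\}\in H\}$. Further $H^{-1}=\{\{k,h\}:\{h,k\}\in H\}$, $-H=\{\{h,-k\}:\{h,k\}\in H\}$, $H-\lambda=\{\{h,k-\lambda h\}:\{h,k\}\in H\}$, and $H^*=\{\{h,k\}:(g,h)=(f,k)\text{ for all }\{f,g\}\in H\}$; $H$ is selfadjoint if $H=H^*$. A selfadjoint relation $H$ decomposes orthogonally as $H=H_s\,\widehat\oplus\,(\{0\}\times\operatorname{mul}H)$ with respect to $\mathfrak H=\operatorname{dom}H\oplus\operatorname{mul}H$, where $H_s=H\cap(\operatorname{dom}H\times\operatorname{dom}H)$ (the operator part) is a selfadjoint operator in $\operatorname{dom}H$. The (finite) eigenvalues of $H$, i.e. the $\lambda$ with $\{h,\lambda h\}\in H$ for some $h\neq0$, are those of $H_s$. The inverse is always taken in the sense of relations. The lower bound of $H$ is the supremum of all $m\in\mathbb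 R$ with $(H_sh,h)\ge m(h,h)$ for all $h\in\operatorname{dom}H$. Ordering: for selfadjoint relations $H_1,H_2$ with lower bounds $m_1,m_2$, $H_1\le H_2$ means that for some fixed $x<\min\{m_1,m_2\}$ (equivalently, for all such $x$) $0\le((H_2-x)^{-1}h,h)\le((H_1-x)^{-1}h,h)$ for all $h\in\mathfrak H$. (In $\mathbb C^n$ this is equivalent to: $\operatorname{dom}H_2\subset\operatorname{dom}H_1$ and $((H_1)_sh,h)\le((H_2)_sh,h)$ for all $h\in\operatorname{dom}H_2$.) *)

(* Defs.v *)
From HB Require Import structures.
From mathcomp Require Import all_boot all_order all_algebra.
From mathcomp Require Import complex.
From mathcomp Require Import all_classical all_reals all_analysis.

Set Implicit Arguments.
Unset Strict Implicit.
Unset Printing Implicit Defensive.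

Import Order.TTheory GRing.Theory Num.Theory.

Local Open Scope classical_set_scope.
Local Open Scope ring_scope.
Local Open Scope complex_scope.

Section LinearMaps.
Variables (K : fieldType) (V : vectType K).

Definition swap_pair (p : V * V) : V * V := (p.2, p.1).
Definition opp_pair (p : V * V) : V * V := (p.1, - p.2).
Definition shift_pair (l : K) (p : V * V) : V * V := (p.1, p.2 - l *: p.1).

Fact swap_pair_linear : linear swap_pair.
Proof. by []. Qed.
HB.instance Definition _ :=
  GRing.isLinear.Build K (V * V)%type (V * V)%type _ swap_pair swap_pair_linear.

Fact opp_pair_linear : linear opp_pair.
Proof.
move=> a [u1 u2] [v1 v2]; congr pair.
by rewrite /= opprD scalerN.
Qed.
HB.instance Definition _ :=
  GRing.isLinear.Build K (V * V)%type (V * V)%type _ opp_pair opp_pair_linear.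

Fact shift_pair_linear l : linear (shift_pair l).
Proof.
move=> a [u1 u2] [v1 v2]; congr pair.
by rewrite /= !scalerDr scalerN !scalerA [a * l]mulrC opprD addrACA.
Qed.
HB.instance Definition _ l :=
  GRing.isLinear.Build K (V * V)%type (V * V)%type _
    (shift_pair l) (shift_pair_linear l).

End LinearMaps.

Section Relations.
Variables (R : realType) (n : nat).
Local Notation C := R[i].
Local Notation V := 'rV[C]_n.

Definition linrel := {vspace (V * V)}.
Implicit Types (H : linrel) (h k : V).

Definition rdom H : {vspace V} := (linfun fst @: H)%VS.

Definition rker H : {vspace V} := (linfun fst @: (H :&: lker (linfun snd)))%VS.

Definition rinv H : linrel := (linfun (@swap_pair C V) @: H)%VS.

Definition ropp H : linrel := (linfun (@opp_pair C V) @: H)%VS.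

Definition rshift H (l : C) : linrel := (linfun (@shift_pair C V l) @: H)%VS.

(* [dotmx] is conjugate-linear in its second argument. *)
Definition radj H : set (V * V) :=
  [set p | forall q, q \in H -> dotmx q.2 p.1 = dotmx q.1 p.2].

Definition selfadjoint H : Prop := [set p | p \in H] = radj H.

Definition opart H : linrel :=
  (H :&: (linfun fst @^-1: rdom H :&: linfun snd @^-1: rdom H))%VS.

(* The value at h of H seen as an operator; it is only meant for h in the
   domain of a single-valued H (otherwise an arbitrary value, or 0). *)
Definition rapp H h : V := xget 0 [set k | (h, k) \in H].

(* Equal to +oo when the domain is {0}. *)
Definition lower_bound H : \bar R :=
  ereal_sup [set m%:E | m in [set m : R |
    forall h, h \in rdom H -> m%:C * dotmx h h <= dotmx (rapp (opart H) h) h]].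

(* [<=] on [R[i]] compares real parts and requires equal imaginary parts. *)
Definition rel_le H1 H2 : Prop :=
  exists2 x : R, (x%:E < Order.min (lower_bound H1) (lower_bound H2))%E &
  forall h,
    0 <= dotmx (rapp (rinv (rshift H2 x%:C)) h) h
      <= dotmx (rapp (rinv (rshift H1 x%:C)) h) h.

Definition reigenvalue H (l : C) : Prop :=
  exists2 h, h != 0 & (h, l *: h) \in H.

(* A selfadjoint relation has finitely many eigenvalues, so the finitely
   supported sum below is the genuine one; l < 0 forces l to be real. *)
Definition neg_eigen_count H : nat :=
  \big[addn/0%N]_(l \in [set l : C | l < 0 /\ reigenvalue H l])
    \dim (rker (rshift H l)).

Definition null_count H : nat := \dim (rker H).

Lemma mem_rdom H h : (h \in rdom H) <-> exists k, (h, k) \in H.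
Proof.
split=> [/memv_imgP[[h' k] Hhk ->]|[k Hhk]].
  by exists k; rewrite lfunE.
by apply/memv_imgP; exists (h, k); rewrite // lfunE.
Qed.

Lemma mem_rker H h : (h \in rker H) = ((h, 0) \in H).
Proof.
apply/memv_imgP/idP => [[[h' k]]|Hh0].
  rewrite memv_cap memv_ker !lfunE /= => /andP[Hhk /eqP k0] ->.
  by rewrite -k0.
by exists (h, 0); rewrite ?memv_cap ?memv_ker ?Hh0 !lfunE /=.
Qed.

Lemma mem_rinv H h k : ((k, h) \in rinv H) = ((h, k) \in H).
Proof.
apply/memv_imgP/idP => [[[h' k'] Hhk]|Hhk].
  by rewrite lfunE => -[-> ->].
by exists (h, k); rewrite // lfunE.
Qed.

Lemma mem_ropp H h k : ((h, k) \in ropp H) = ((h, - k) \in H).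
Proof.
apply/memv_imgP/idP => [[[h' k'] Hhk]|Hhk].
  by rewrite lfunE => -[-> ->]; rewrite opprK.
by exists (h, - k); rewrite // lfunE /= /opp_pair opprK.
Qed.

Lemma mem_rshift H l h k : ((h, k) \in rshift H l) = ((h, k + l *: h) \in H).
Proof.
apply/memv_imgP/idP => [[[h' k'] Hhk]|Hhk].
  by rewrite lfunE => -[-> ->]; rewrite /= subrK.
by exists (h, k + l *: h); rewrite // lfunE /= /shift_pair /= addrK.
Qed.

Lemma mem_opart H h k :
  ((h, k) \in opart H) = [&& (h, k) \in H, h \in rdom H & k \in rdom H].
Proof.
rewrite memv_cap; congr (_ && _); rewrite memv_cap; congr (_ && _).
  by rewrite -memv_preim lfunE.
by rewrite -memv_preim lfunE.
Qed.

Lemma rapp_eq H h k : (forall k', (0, k') \in H -> k' = 0) ->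
  (h, k) \in H -> rapp H h = k.
Proof.
move=> mul0 Hhk; apply: xget_unique => //= k' Hhk'.
apply/eqP; rewrite -subr_eq0; apply/eqP/mul0.
by rewrite (_ : (0, k' - k) = (h, k') - (h, k)) ?rpredB //; congr pair; rewrite /= subrr.
Qed.

End Relations.

(* Main.v *)
(* For a selfadjoint H the number (k, h), {h, k} in H, depends only on h, so H
   carries a form on dom H, and the resolvent ordering is the ordering of forms:
   dom H2 is contained in dom H1 and t1 <= t2 there (inversion of nonnegative
   relations is antitone).  A diagonalisation of H, obtained from its unitary
   Cayley transform, splits C^n into the sum N of the eigenspaces for
   eigenvalues <= 0 and its orthogonal complement, with dim N = i^- + i^0.  If
   t1 <= t2, then N2 meets the complement of N1 trivially, so
   dim N2 <= dim N1; the same argument for the inverses gives the reverse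
   inequality when -H1^{-1} <= -H2^{-1}.  Conversely, if the dimensions agree,
   then N2 is a nonpositive subspace of maximal dimension for t1.  Maximality
   forces ker H1 into ker H2, that is, ran H2 into ran H1.  For {h1, k} in H1
   and {h2, k} in H2 with (h1, k) < (h2, k), the form t1 would be negative on
   h1 - h2 + N2, which again contradicts maximality. *)

Require Import Defs.
From mathcomp Require Import all_boot all_order all_algebra.
From mathcomp Require Import all_classical all_reals all_analysis.
From mathcomp Require Import complex ring.
(* fintype also exports an [rshift]; the one meant here is that of [Defs]. *)
Import Defs.

Set Implicit Arguments.
Unset Strict Implicit.
Unset Printing Implicit Defensive.

Import Order.TTheory GRing.Theory Num.Theory.

Local Open Scope ring_scope.
Local Open Scope sesquilinear_scope.

Local Notation "x %:C" := (real_complex _ x) : ring_scope.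
Local Notation "''[' u , v ]" := (dotmx u v) : ring_scope.

(** * The Hermitian inner product on row vectors *)

Section DotProduct.
Variables (C : numClosedFieldType) (n : nat).
Local Notation V := 'rV[C]_n.
Implicit Types (u v w : V) (c : C).

Lemma dotDl u v w : '[u + v, w] = '[u, w] + '[v, w].
Proof. exact: linearDl. Qed.

Lemma dotDr u v w : '[u, v + w] = '[u, v] + '[u, w].
Proof. exact: linearDr. Qed.

Lemma dotNl u v : '[- u, v] = - '[u, v].
Proof. exact: linearNl. Qed.

Lemma dotNr u v : '[u, - v] = - '[u, v].
Proof. exact: linearNr. Qed.

Lemma dotZl c u v : '[c *: u, v] = c * '[u, v].
Proof. exact: linearZl_LR. Qed.

Lemma dotZr c u v : '[u, c *: v] = c^* * '[u, v].
Proof. exact: linearZr. Qed.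

Lemma dot0l u : '[0, u] = 0.
Proof. exact: linear0l. Qed.

Lemma dot0r u : '[u, 0] = 0.
Proof. exact: linear0r. Qed.

Lemma dotC u v : '[v, u] = '[u, v]^*.
Proof. by rewrite hermC /= expr0 mul1r. Qed.

Lemma dot_ge0 u : 0 <= '[u, u].
Proof. exact: dnorm_ge0. Qed.

Lemma dot_eq0 u : '[u, u] = 0 -> u = 0.
Proof. by move/eqP; rewrite dnorm_eq0 => /eqP. Qed.

Lemma real_ge0_cross_eq0 (a b : C) : a \is Num.real ->
  (forall c, 0 <= a + c^* * b + c * b^*) -> b = 0.
Proof.
move=> a_real pos; apply/eqP; apply: contraT => b0.
have bc0 : b^* != 0 by rewrite fmorph_eq0.
(* For [c = t b] with [t] real the expression is [a + 2 t |b|^2]; this [t] makes it [-1]. *)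
pose t := - (a + 1) / (2 * (b * b^*)).
have tc : t^* = t.
  rewrite /t !(rmorphM, rmorphN, rmorphD, fmorphV, rmorph1, conjC_nat) /= conjCK.
  by rewrite (conj_Creal a_real) [b^* * b]mulrC.
have := pos (t * b); rewrite rmorphM /= tc.
have -> : a + t * b^* * b + t * b * b^* = -1.
  by rewrite /t; field; rewrite bc0 b0.
by rewrite oppr_ge0 ler10.
Qed.

End DotProduct.

(** * Selfadjoint relations and the ordering of their forms *)

(* Linear relations are handled here as predicates on pairs; selfadjointness
   alone forces linearity. *)
Section Relations.
Variables (C : numClosedFieldType) (n : nat).
Local Notation V := 'rV[C]_n.
Implicit Types (H : V -> V -> Prop) (h k u v w z : V) (c : C).

Definition sa H : Prop :=
  forall h k, H h k <-> (forall h' k', H h' k' -> '[k', h] = '[h', k]).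

Definition inv_rel H : V -> V -> Prop := fun h k => H k h.
Definition opp_rel H : V -> V -> Prop := fun h k => H h (- k).
Definition shift_rel H c : V -> V -> Prop := fun h k => H h (k + c *: h).

Lemma sa_sym H h k h' k' : sa H -> H h k -> H h' k' -> '[k', h] = '[h', k].
Proof. by move=> saH /saH; apply. Qed.

Lemma sa_mem H h k :
  sa H -> (forall h' k', H h' k' -> '[k', h] = '[h', k]) -> H h k.
Proof. by move=> saH /saH. Qed.

Lemma sa_add H h k h' k' : sa H -> H h k -> H h' k' -> H (h + h') (k + k').
Proof.
move=> saH Hhk Hhk'; apply: (sa_mem saH) => g l Hgl.
by rewrite !dotDr (sa_sym saH Hhk Hgl) (sa_sym saH Hhk' Hgl).
Qed.

Lemma sa_scale H c h k : sa H -> H h k -> H (c *: h) (c *: k).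
Proof.
move=> saH Hhk; apply: (sa_mem saH) => g l Hgl.
by rewrite !dotZr (sa_sym saH Hhk Hgl).
Qed.

Lemma sa_sub H h k h' k' : sa H -> H h k -> H h' k' -> H (h - h') (k - k').
Proof.
by move=> saH Hhk /(sa_scale (-1) saH); rewrite !scaleN1r; exact: sa_add.
Qed.

Lemma sa_0 H : sa H -> H 0 0.
Proof. by move=> saH; apply: (sa_mem saH) => g l _; rewrite !dot0r. Qed.

Lemma sa_sum H (I : Type) (r : seq I) (F G : I -> V) : sa H ->
  (forall i, H (F i) (G i)) -> H (\sum_(i <- r) F i) (\sum_(i <- r) G i).
Proof.
move=> saH HFG; elim: r => [|i r IHr]; first by rewrite !big_nil; exact: sa_0.
by rewrite !big_cons; apply: sa_add.
Qed.

Lemma sa_form_real H h k : sa H -> H h k -> '[k, h] \is Num.real.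
Proof. by move=> saH Hhk; rewrite CrealE -dotC (sa_sym saH Hhk Hhk). Qed.

Lemma sa_inv H : sa H -> sa (inv_rel H).
Proof.
move=> saH k h; rewrite /inv_rel; split=> [Hhk k' h' Hhk'|Hsym].
  by rewrite (sa_sym saH Hhk Hhk').
by apply: (sa_mem saH) => h' k' Hhk'; rewrite (Hsym k' h').
Qed.

Lemma sa_opp H : sa H -> sa (opp_rel H).
Proof.
move=> saH h k; rewrite /opp_rel; split=> [Hhk h' k' Hhk'|Hsym].
  have := sa_sym saH Hhk Hhk'.
  by rewrite dotNl dotNr => /oppr_inj.
apply: (sa_mem saH) => h' k' Hhk'.
by rewrite dotNr -(Hsym h' (- k')) ?opprK// dotNl opprK.
Qed.

Lemma sa_shift H c : c \is Num.real -> sa H -> sa (shift_rel H c).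
Proof.
move=> c_real saH h k; rewrite /shift_rel.
split=> [Hhk h' k' Hhk'|Hsym].
  have := sa_sym saH Hhk Hhk'.
  by rewrite dotDl dotDr dotZl dotZr conj_Creal// => /addIr.
apply: (sa_mem saH) => h' k' Hhk'.
have := Hsym h' (k' - c *: h'); rewrite subrK => /(_ Hhk').
by rewrite dotDl dotNl dotDr dotZl dotZr conj_Creal// => <-; rewrite subrK.
Qed.

(* For a selfadjoint [H] the number [(k, h)] depends only on [h] when [{h, k}]
   ranges over [H], so this says that [dom H2] is contained in [dom H1], where
   the form of [H1] is dominated by that of [H2]. *)
Definition form_le H1 H2 : Prop :=
  forall h k2, H2 h k2 -> exists2 k1, H1 h k1 & '[k1, h] <= '[k2, h].

Lemma form_le_shift H1 H2 c :
  form_le (shift_rel H1 c) (shift_rel H2 c) <-> form_le H1 H2.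
Proof.
split=> le12 h k2 Hk2.
  have [|k1 Hk1] := le12 h (k2 - c *: h); first by rewrite /shift_rel subrK.
  rewrite !dotDl dotNl dotZl lerBrDr => le.
  by exists (k1 + c *: h); rewrite // dotDl dotZl.
have [k1 Hk1] := le12 _ _ Hk2; rewrite !dotDl dotZl -lerBlDr => le.
by exists (k1 - c *: h); rewrite /shift_rel ?subrK // dotDl dotNl dotZl.
Qed.

(* Expand the form of [H1] at [h1 - w] for [w = h2 - v] in [dom H2]; the cross
   terms only involve [k], and the quadratic term in [w] is dominated by [H2]. *)
Lemma form_le_dual H1 H2 h1 h2 k v v' : sa H1 -> sa H2 -> form_le H1 H2 ->
  H1 h1 k -> H2 h2 k -> H2 v v' ->
  exists2 u', H1 (h1 - h2 + v) u' &
    '[u', h1 - h2 + v] <= '[k, h1] - '[k, h2] + '[v', v].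
Proof.
move=> sa1 sa2 le12 Hh1 Hh2 Hv.
have [w' Hw le_w] := le12 _ _ (sa_sub sa2 Hh2 Hv).
have e1 := sa_sym sa1 Hh1 Hw.
have e2 := sa_sym sa2 Hh2 Hv.
have e3 := sa_sym sa2 Hh2 Hh2.
have -> : h1 - h2 + v = h1 - (h2 - v) by rewrite opprB addrA addrAC.
exists (k - w'); first exact: sa_sub.
set w := h2 - v in le_w *.
have -> : '[k - w', h1 - w] =
    '[k, h1] - '[k, h2] + '[k, v] - '[h2, k] + '[v, k] + '[w', w].
  rewrite dotDl dotNl ![in LHS]dotDr !dotNr e1 /w !(dotDl, dotDr, dotNl, dotNr).
  by ring.
have -> : '[k, h1] - '[k, h2] + '[v', v] =
    '[k, h1] - '[k, h2] + '[k, v] - '[h2, k] + '[v, k] + '[k - v', w].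
  by rewrite /w !(dotDl, dotDr, dotNl, dotNr) e2 e3; ring.
by rewrite lerD2l.
Qed.

(* [H2 - H1] is a nonnegative form vanishing at [z], so [z] lies in its radical. *)
Lemma form_le_ker H1 H2 z z' : sa H1 -> sa H2 -> form_le H1 H2 ->
  H1 z 0 -> H2 z z' -> '[z', z] = 0 -> H2 z 0.
Proof.
move=> sa1 sa2 le12 Hz1 Hz2 z0; apply: (sa_mem sa2) => h k Hhk; rewrite dot0r.
have [k0 Hk0 _] := le12 _ _ Hhk.
(* Both forms vanish at [z], so their difference at [h + c z] has no [|c|^2] term. As [z] is in ker
   H1, only the cross terms of [H2] remain, with [b = '[k, z]]. *)
apply: (@real_ge0_cross_eq0 _ ('[k, h] - '[k0, h])).
  by rewrite rpredB // ?(sa_form_real _ Hhk) ?(sa_form_real _ Hk0).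
move=> c; have [k1 Hk1] := le12 _ _ (sa_add sa2 Hhk (sa_scale c sa2 Hz2)).
rewrite -subr_ge0; congr (0 <= _).
have e1 := sa_sym sa1 Hz1 Hk1.
have e2 := sa_sym sa1 Hk0 Hk1.
have e4 := sa_sym sa2 Hhk Hz2.
have e5 : '[z, k0] = 0 by rewrite -(sa_sym sa1 Hk0 Hz1) dot0l.
rewrite [X in _ - X]dotDr dotZr e1 dot0r e2 !(dotDl, dotDr, dotZl, dotZr) z0 e4 e5.
by rewrite (dotC k z) (sa_sym sa1 Hk0 Hk0); ring.
Qed.

End Relations.

(** * Diagonalisation of a selfadjoint relation *)

Section Spectral.
Variables (C : numClosedFieldType) (n : nat).
Local Notation V := 'rV[C]_n.
Implicit Types (h k u v w z : V) (c : C).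

(** Let the rows of [M] be a basis of [W]. Vectors orthogonal to [W] form the left kernel of
    [M ^t*]; if it is trivial, [M] has rank [n]. *)
Lemma full_of_no_ortho (W : {vspace V}) :
  (forall v, (forall w, w \in W -> '[w, v] = 0) -> v = 0) -> forall v, v \in W.
Proof.
move=> W0 v; set X := vbasis W.
pose M : 'M[C]_(\dim W, n) := \matrix_j X`_j.
have MW w : (w <= M)%MS -> w \in W.
  move=> /submxP[D ->]; rewrite mulmx_sum_row memv_suml // => j _.
  by rewrite memvZ // rowK vbasis_mem // mem_nth // size_tuple.
have WM w : w \in W -> exists D, w = D *m M.
  move=> ww; exists (\row_j coord X j w).
  rewrite mulmx_sum_row {1}(coord_vbasis ww); apply: eq_bigr => j _.
  by rewrite mxE rowK.
have M0 : kermx (M ^t*) = 0.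
  apply/row_matrixP => i; rewrite row0; apply: W0 => w /WM[D ->].
  rewrite dotmxE -mulmxA.
  set K := kermx _.
  have ker0 : row i K *m M ^t* = 0 by rewrite -row_mul mulmx_ker row0.
  suff -> : M *m (row i K) ^t* = 0 by rewrite mulmx0 mxE.
  rewrite -[LHS]trmxCK trmx_mul map_mxM -/(_ ^t*) trmxCK.
  by rewrite ker0 trmx0 map_mx0.
apply: MW; apply: submx_full.
have /eqP := M0; rewrite kermx_eq0 /row_free mxrank_map mxrank_tr.
by [].
Qed.

Variable H : {vspace V * V}.
Local Notation HH := (fun h k => (h, k) \in H).

(* [H + i] is onto: a vector [v] orthogonal to its range gives [{v, iv}] in
   [H], hence a nonreal value of the form unless [v = 0]. *)
Lemma sa_addi_onto : sa HH -> forall f, exists h, (h, f - 'i *: h) \in H.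
Proof.
move=> saH f.
pose W := ((linfun snd + 'i *: linfun fst) @: H)%VS.
suff : f \in W.
  move=> /memv_imgP[[h k] Hhk]; rewrite lfunE /= scale_lfunE !lfunE /= => ->.
  by exists h; rewrite addrK.
apply: full_of_no_ortho => v Wv.
have Hv : (v, 'i *: v) \in H.
  apply: (sa_mem saH) => h k Hhk.
  have /Wv : k + 'i *: h \in W.
    by apply/memv_imgP; exists (h, k); rewrite // lfunE /= scale_lfunE !lfunE.
  by rewrite dotDl dotZl dotZr conjCi mulNr => /eqP; rewrite addr_eq0 => /eqP.
have /eqP := sa_sym saH Hv Hv; rewrite dotZl dotZr conjCi -subr_eq0 mulNr opprK.
rewrite -mulr2n mulrn_eq0 mulf_eq0 /= (negPf (neq0Ci _)) => /eqP.
exact: dot_eq0.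
Qed.

(* The Cayley transform [k + ih |-> k - ih] of [H] is unitary; an eigenvector
   [e] for the eigenvalue [u] yields [{h, k}] in [H] with
   [k + ih = e] and [k - ih = u e]. *)
Lemma sa_spectral : sa HH ->
  exists P : 'M[C]_n, exists2 s : 'I_n -> option C, P \is unitarymx &
  forall i, if s i is Some l then l \is Num.real /\ (row i P, l *: row i P) \in H
            else (0, row i P) \in H.
Proof.
move=> saH.
(* [a j] is [(H + i)^-1] applied to the [j]-th unit vector, so [A] is the matrix of this resolvent
   acting on rows. *)
have /fin_all_exists[a Ha] (j : 'I_n) := sa_addi_onto saH (delta_mx 0 j).
pose A := \matrix_j a j.
have HA f : (f *m A, f - 'i *: (f *m A)) \in H.
  have := @sa_sum _ _ HH _ (index_enum 'I_n) _ _ saH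
    (fun j => sa_scale (f 0 j) saH (Ha j)).
  have E : f *m A = \sum_j f 0 j *: a j.
    by rewrite mulmx_sum_row; apply: eq_bigr => j _; rewrite rowK.
  congr ((_, _) \in H); first by rewrite E.
  rewrite {2}[f]row_sum_delta E scaler_sumr -sumrN -big_split /=.
  by apply: eq_bigr => j _; rewrite scalerBr !scalerA mulrC.
(* [f = k + ih] is sent to [f - 2ih = k - ih]. *)
pose U := 1%:M - (2 * 'i) *: A.
have Uunitary : U \is unitarymx.
  apply/row_unitarymxP => i j.
  have -> : row i U = delta_mx 0 i - (2 * 'i) *: a i.
    by rewrite linearB linearZ /= rowK row1.
  have -> : row j U = delta_mx 0 j - (2 * 'i) *: a j.
    by rewrite linearB linearZ /= rowK row1.
  have <- : '[delta_mx 0 i : V, delta_mx 0 j : V] = (i == j)%:R :> C.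
    have /row_unitarymxP/(_ i j) : (1%:M : 'M[C]_n) \is unitarymx.
      by apply/unitarymxP; rewrite mul1mx trmx1 map_mx1.
    by rewrite !row1.
  have E := sa_sym saH (Ha j) (Ha i).
  set x := a i in E *; set y := a j in E *.
  set e := delta_mx 0 i in E *; set d := delta_mx 0 j in E *.
  rewrite !(dotDl, dotDr, dotNl, dotNr, dotZl, dotZr) conjCi in E.
  have c2 : (2 * 'i : C)^* = - (2 * 'i) by rewrite rmorphM /= conjC_nat conjCi mulrN.
  rewrite !(dotDl, dotDr, dotNl, dotNr, dotZl, dotZr) c2 {c2}.
  move: E; have := sqrCi C; move: 'i => I I2 E.
  have {}E : '[e, y] = '[x, d] + 2 * I * '[x, y] by rewrite -[LHS](subrK (I * '[x, y])) E; ring.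
  rewrite E; have {}I2 : I * I = -1 by rewrite -expr2.
  ring: I2.
have /orthomx_spectralP : U \is normalmx.
  apply/normalmxP; rewrite (unitarymxP _) //; apply/esym/mulmx1C.
  exact/unitarymxP.
set P := spectralmx U; set D := spectral_diag U => UE.
have Punit : P \in unitmx by exact: spectral_unit.
have PU i : row i P *m U = D 0 i *: row i P.
  by rewrite -row_mul [in LHS]UE !mulmxA mulmxV // mul1mx row_mul row_diag_mx -scalemxAl -rowE.
have P1 i : '[row i P, row i P] = 1.
  by have /row_unitarymxP -> := spectral_unitarymx U; rewrite eqxx.
exists P.
suff /fin_all_exists[s Hs] (i : 'I_n) : exists o : option C,
    if o is Some l then l \is Num.real /\ (row i P, l *: row i P) \in H
    else (0, row i P) \in H.
  by exists s => //; exact: spectral_unitarymx.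
set e := row i P.
have := HA e; have := PU i; rewrite -/e /U mulmxBr mulmx1 -scalemxAr.
set g := e *m A; move=> Dg.
(* For the eigenvalue 1 of [U] the first component [g] vanishes, so [e] lies in mul H; [None]
   records this infinite eigenvalue. *)
have [D1|D1] := eqVneq (D 0 i) 1.
  have -> : g = 0.
    move/eqP: Dg; rewrite D1 scale1r -[X in _ == X]subr0 (inj_eq (addrI _)).
    rewrite eqr_opp scaler_eq0 mulf_eq0 pnatr_eq0 /= (negPf (neq0Ci _)) /= => /eqP ->//.
  by rewrite scaler0 subr0; exists None.
have c0 : 2 * 'i != 0 :> C by rewrite mulf_neq0 ?neq0Ci ?pnatr_eq0.
have -> : g = ((1 - D 0 i) / (2 * 'i)) *: e.
  apply: (scalerI c0); rewrite scalerA mulrCA divff // mulr1 scalerBl scale1r -Dg.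
  by rewrite opprB addrC subrK.
set c := _ / _; have cn0 : c != 0 by rewrite mulf_neq0 ?invr_eq0 // subr_eq0 eq_sym.
move=> /(sa_scale c^-1 saH); rewrite scalerA mulVf // scale1r => He.
have {}He : (e, (c^-1 - 'i) *: e) \in H.
  rewrite [_ *: e](_ : _ = c^-1 *: (e - 'i *: (c *: e))) //.
  by rewrite scalerBr !scalerA mulrAC mulVf // mul1r scalerBl.
(* This number is real, being the value of the form of [H] at the unit vector [e]. *)
exists (Some (c^-1 - 'i)); split=> //.
by have := sa_form_real saH He; rewrite dotZl P1 mulr1.
Qed.

End Spectral.

(** * Coordinates in an orthonormal basis *)

Section OrthonormalBasis.
Variables (C : numClosedFieldType) (n : nat) (P : 'M[C]_n).
Hypothesis Punitary : P \is unitarymx.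
Local Notation V := 'rV[C]_n.
Local Notation e := (fun i => row i P).
Implicit Types (h k : V) (A : pred 'I_n).

Lemma dot_suml (I : Type) (r : seq I) (F : I -> V) k :
  '[\sum_(i <- r) F i, k] = \sum_(i <- r) '[F i, k].
Proof. by apply: (big_morph (fun u => '[u, k])) => [u v|]; rewrite ?dotDl ?dot0l. Qed.

Lemma dot_basis i j : '[e i, e j] = (i == j)%:R.
Proof. by move/row_unitarymxP: Punitary. Qed.

Lemma dot_coords (c : 'I_n -> C) i : '[\sum_j c j *: e j, e i] = c i.
Proof.
rewrite dot_suml (bigD1 i) //= dotZl dot_basis eqxx mulr1 big1 ?addr0 // => j ji.
by rewrite dotZl dot_basis (negPf ji) mulr0.
Qed.

Lemma basis_expand h : h = \sum_i '[h, e i] *: e i.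
Proof.
rewrite -[LHS](mulmxKtV h Punitary erefl) mulmx_sum_row; apply: eq_bigr => i _.
by rewrite dotmxE !mxE; congr (_ *: _); apply: eq_bigr => j _; rewrite !mxE.
Qed.

Lemma coords_eq0 h : (forall i, '[h, e i] = 0) -> h = 0.
Proof.
by move=> h0; rewrite [h]basis_expand big1 // => i _; rewrite h0 scale0r.
Qed.

Lemma dot_expand h k : '[h, k] = \sum_i '[h, e i] * '[k, e i]^*.
Proof.
rewrite {1}[h]basis_expand dot_suml; apply: eq_bigr => i _.
by rewrite dotZl (dotC k).
Qed.

Definition coordspace A : {vspace V} := <<[seq e i | i <- enum A]>>%VS.

Lemma coordspaceP A h :
  reflect (forall i, ~~ A i -> '[h, e i] = 0) (h \in coordspace A).
Proof.
apply: (iffP idP) => [hA i iA|h0].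
  rewrite (coord_span (X := in_tuple [seq e j | j <- enum A]) hA) dot_suml.
  rewrite big1 // => j _; rewrite dotZl.
  have /mapP[l lA ->] : [seq e j | j <- enum A]`_j \in [seq e j | j <- enum A].
    exact: mem_nth.
  rewrite dot_basis; case: eqP => [li|_]; last by rewrite mulr0.
  by move: lA; rewrite mem_enum li unfold_in (negPf iA).
rewrite [h]basis_expand memv_suml // => i _.
have [iA|/h0 ->] := boolP (A i); last by rewrite scale0r mem0v.
by apply/memvZ/memv_span/mapP; exists i; rewrite ?mem_enum.
Qed.

(** The spanning set gives one inequality. The other follows by counting, since the spaces of [A]
    and of its complement together span everything. *)
Lemma dim_coordspace A : \dim (coordspace A) = #|A|.
Proof.
have dim_le B : (\dim (coordspace B) <= #|B|)%N.
  by apply: leq_trans (dim_span _) _; rewrite size_map cardE.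
apply/eqP; rewrite eqn_leq dim_le /=.
have full : (fullv <= coordspace A + coordspace (predC A))%VS.
  apply/subvP => h _; rewrite [h]basis_expand memv_suml // => i _.
  apply: memvZ; have [iA|iA] := boolP (A i).
    apply: (subvP (addvSl _ _)); apply/coordspaceP => j jA.
    by rewrite dot_basis; case: eqP jA => // <-; rewrite iA.
  apply: (subvP (addvSr _ _)); apply/coordspaceP => j /=.
  by rewrite negbK dot_basis; case: eqP => // ij; rewrite -ij (negPf iA).
have := dimvS full; rewrite dimvf /dim /= mul1n.
move=> /leq_trans/(_ (dimv_add_leqif _ _)); rewrite -[X in (X <= _)%N]card_ord -(cardC A).
move=> le; rewrite -(leq_add2r #|predC A|); apply: leq_trans le _.
by rewrite leq_add2l dim_le.
Qed.

End OrthonormalBasis.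

(** * Diagonalised relations in coordinates *)

Section Diagonal.
Variables (C : numClosedFieldType) (n : nat).
Local Notation V := 'rV[C]_n.
Variables (H : V -> V -> Prop) (P : 'M[C]_n) (s : 'I_n -> option C).
Hypotheses (saH : sa H) (Punitary : P \is unitarymx).
Hypothesis Hs : forall i,
  if s i is Some l then l \is Num.real /\ H (row i P) (l *: row i P)
  else H 0 (row i P).
Local Notation e := (fun i => row i P).
Implicit Types (h k z : V).

(** Forward, symmetry is tested against the basis pairs of [Hs]; backward, the two inner products
    agree term by term in coordinates. *)
Lemma diag_memP h k : H h k <->
  forall i, if s i is Some l then '[k, e i] = l * '[h, e i] else '[h, e i] = 0.
Proof.
split=> [Hhk i|hk].
  have := Hs i; case: (s i) => [l [l_real Hi]|Hi].
    by rewrite (sa_sym saH Hi Hhk) dotZr conj_Creal.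
  by rewrite -(sa_sym saH Hi Hhk) dot0r.
apply: (sa_mem saH) => h' k' Hhk'; rewrite !(dot_expand Punitary).
apply: eq_bigr => i _.
have := hk i; have := Hs i; case: (s i) => [l [l_real Hi] ->|Hi ->].
  by rewrite (sa_sym saH Hi Hhk') dotZr rmorphM /= conj_Creal // mulrCA mulrA.
by rewrite -(sa_sym saH Hi Hhk') dot0r conjC0 mulr0 mul0r.
Qed.

Lemma diag_form h k : H h k ->
  '[k, h] = \sum_i if s i is Some l then l * ('[h, e i] * '[h, e i]^*) else 0.
Proof.
move=> /diag_memP hk; rewrite (dot_expand Punitary); apply: eq_bigr => i _.
by have := hk i; case: (s i) => [l ->|->]; rewrite ?mulrA // conjC0 mulr0.
Qed.

Lemma diag_eigenspaceP (c : C) h :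
  (h \in coordspace P (fun i => s i == Some c)) <-> H h (c *: h).
Proof.
split=> [/coordspaceP-/(_ Punitary) hc|/diag_memP hc].
  apply/diag_memP => i; rewrite dotZl; have := hc i.
  case: (s i) => [l|]; last by apply.
  by case: (eqVneq l c) => [->//|lc]; rewrite (inj_eq Some_inj) lc => ->; rewrite ?mulr0.
apply/coordspaceP => // i; have := hc i; rewrite dotZl.
case: (s i) => [l /eqP|//]; rewrite (inj_eq Some_inj) -subr_eq0 -mulrBl mulf_eq0.
by rewrite subr_eq0 eq_sym => /orP[->//|/eqP].
Qed.

Lemma diag_dom h :
  (forall i, s i = None -> '[h, e i] = 0) -> exists k, H h k.
Proof.
move=> h0; exists (\sum_i (if s i is Some l then l * '[h, e i] else 0) *: e i).
apply/diag_memP => i; rewrite dot_coords //.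
by have := h0 i; case: (s i) => // ->.
Qed.

(** Dropping from [k] its components along mul H leaves a vector of dom H, which gives the value of
    the operator part at [h]. *)
Lemma diag_opart h k : H h k -> exists k' l, H h k' /\ H k' l.
Proof.
move=> /diag_memP Hhk.
pose k' := \sum_i (if s i is Some l then l * '[h, e i] else 0) *: e i.
have [|l Hl] := @diag_dom k'; first by move=> i si; rewrite dot_coords // si.
exists k', l; split=> //; apply/diag_memP => i; rewrite dot_coords //.
by have := Hhk i; case: (s i).
Qed.

(** Coordinates are divided by the eigenvalues. Where an eigenvalue is 0, the basis vector is in the
    kernel and the coordinate of [k] vanishes. *)
Lemma diag_ran k :
  (forall z, H z 0 -> '[k, z] = 0) -> exists h, H h k.
Proof.
move=> k_ortho; pose c i := if s i is Some l then '[k, e i] / l else 0.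
exists (\sum_i c i *: e i); apply/diag_memP => i; rewrite dot_coords // /c.
have := Hs i; case: (s i) => // l [_ Hi].
have [l0|l0] := eqVneq l 0; last by rewrite mulrCA divff ?mulr1.
by move: Hi; rewrite l0 scale0r => /k_ortho ->; rewrite mul0r.
Qed.

Lemma diag_bounded : exists2 m : C, m \is Num.real &
  forall h k, H h k -> m * '[h, h] <= '[k, h].
Proof.
(* Minus the sum of all [|l|] is a crude lower bound; coordinates at [None] vanish on the domain. *)
pose a i := if s i is Some l then `|l| else 0.
have a_ge0 i : 0 <= a i by rewrite /a; case: (s i).
have sum_real : \sum_i a i \is Num.real by rewrite ger0_real // sumr_ge0.
exists (- \sum_i a i) => [|h k Hhk]; first by rewrite rpredN.
rewrite (diag_form Hhk) (dot_expand Punitary) mulr_sumr; apply: ler_sum => i _.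
have le_a : a i <= \sum_j a j by rewrite (bigD1 i) //= lerDl sumr_ge0.
have := Hs i; have := le_a; rewrite {1}/a.
case: (s i) => [l le_l [l_real _]|le_l _].
  apply: ler_wpM2r; first exact: mul_conjC_ge0.
  by rewrite lerNl; apply: le_trans le_l; rewrite -normrN real_ler_norm // rpredN.
by rewrite mulNr oppr_le0 mulr_ge0 ?mul_conjC_ge0.
Qed.

(** [None] acts as the eigenvalue +oo, so mul H falls on the positive side. *)
Definition nonpos i := if s i is Some l then l <= 0 else false.

Lemma nonposP i l : s i = Some l -> if nonpos i then l <= 0 else 0 < l.
Proof.
rewrite /nonpos => si; have := Hs i; rewrite si => -[l_real _].
by case: ifP => // /negbT; rewrite -real_ltNge.
Qed.

Local Notation N := (coordspace P nonpos).
Local Notation Q := (coordspace P (predC nonpos)).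

Lemma nonpos_form z : z \in N -> exists2 k, H z k & '[k, z] <= 0.
Proof.
move=> /(coordspaceP Punitary) zN.
have [|k Hk] := @diag_dom z; first by move=> i si; rewrite zN // /nonpos si.
exists k => //; rewrite (diag_form Hk) sumr_le0 // => i _.
have := zN i; case E: (s i) => [l|//]; have := nonposP E; case: ifP => _.
  by move=> l0 _; rewrite mulr_le0_ge0 ?mul_conjC_ge0.
by move=> _ ->; rewrite // mul0r mulr0.
Qed.

Lemma pos_form z k : z \in Q -> H z k -> z != 0 -> 0 < '[k, z].
Proof.
move=> /(coordspaceP Punitary) zQ Hzk z0; rewrite (diag_form Hzk).
have pos i : '[z, e i] != 0 -> exists2 l, s i = Some l & 0 < l.
  move=> zi; move/diag_memP/(_ i): Hzk; case E: (s i) => [l|]; last first.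
    by move=> zi0; rewrite zi0 eqxx in zi.
  exists l => //; have := nonposP E; case: ifP => // iN.
  by rewrite zQ ?eqxx /= ?negbK in zi.
have [i zi] : exists i, '[z, e i] != 0.
  apply/existsP; apply: contraNT z0; rewrite negb_exists => /forallP zi.
  by apply/eqP/(coords_eq0 Punitary) => i; apply/eqP; rewrite -[_ == _]negbK zi.
rewrite (bigD1 i) //= ltr_wpDr ?sumr_ge0 // => [j _|].
  have [zj|/pos[l -> l0]] := eqVneq '[z, e j] 0.
    by rewrite zj mul0r; case: (s j) => [l|//]; rewrite mulr0.
  by rewrite mulr_ge0 ?mul_conjC_ge0 // ltW.
by have [l -> l0] := pos _ zi; rewrite mulr_gt0 // mul_conjC_gt0.
Qed.

(** [Q] is orthogonal to the kernel, hence inside the range. It contains mul H, the kernel of the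
    inverse, so the inequality is weak. *)
Lemma nonneg_inv_form z : z \in Q -> exists2 h, H h z & 0 <= '[h, z].
Proof.
move=> /(coordspaceP Punitary) zQ.
pose c i := if s i is Some l then '[z, e i] / l else 0.
have Hh : H (\sum_i c i *: e i) z.
  apply/diag_memP => i; rewrite dot_coords // /c.
  case E: (s i) => [l|//]; have := nonposP E; case: ifP => [iN _|_ l0].
    by rewrite zQ ?mul0r ?mulr0 //= negbK.
  by rewrite mulrCA divff ?mulr1 // gt_eqF.
exists (\sum_i c i *: e i) => //; rewrite -(sa_sym saH Hh Hh) (diag_form Hh).
rewrite sumr_ge0 // => i _; rewrite dot_coords // /c.
case E: (s i) => [l|//]; have := nonposP E; case: ifP => [iN _|_ l0].
  by rewrite zQ ?mul0r ?mulr0 //= negbK.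
by rewrite mulr_ge0 ?mul_conjC_ge0 // ltW.
Qed.

(** A range vector in [N] has no component along ker H, so only strictly negative eigenvalues
    contribute. *)
Lemma neg_inv_form h z : z \in N -> H h z -> z != 0 -> '[h, z] < 0.
Proof.
move=> /(coordspaceP Punitary) zN Hhz z0.
rewrite -(sa_sym saH Hhz Hhz) (diag_form Hhz).
have [i zi] : exists i, '[z, e i] != 0.
  apply/existsP; apply: contraNT z0; rewrite negb_exists => /forallP zi.
  by apply/eqP/(coords_eq0 Punitary) => i; apply/eqP; rewrite -[_ == _]negbK zi.
have le0 j : (if s j is Some l then l * ('[h, e j] * '[h, e j]^*) else 0) <= 0.
  move/diag_memP/(_ j): Hhz; case E: (s j) => [l|//]; have := nonposP E.
  case: ifP => [_ l0 _|jN l0].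
    by rewrite mulr_le0_ge0 ?mul_conjC_ge0.
  rewrite zN ?jN // => /esym/eqP; rewrite mulf_eq0 gt_eqF //= => /eqP ->.
  by rewrite mul0r mulr0.
rewrite (bigD1 i) //= ltr_wnDr ?sumr_le0 //.
have iN : nonpos i by apply: contraNT zi => /zN ->.
move: (iN) zi; rewrite /nonpos; move/diag_memP/(_ i): Hhz.
case: (s i) => [l ->|//]; rewrite mulf_eq0 negb_or => l0 /andP[ln0 hi].
by rewrite nmulr_rlt0 ?mul_conjC_gt0 // lt_neqAle ln0.
Qed.

End Diagonal.

(** * Spectral splittings and their dimensions *)

Section Splitting.
Variables (C : numClosedFieldType) (n : nat).
Local Notation V := 'rV[C]_n.
Implicit Types (H : V -> V -> Prop) (N Q : {vspace V}) (h k u v w z : V).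

(** The kernel sits in [N] and mul H in [Q]; inversion swaps these two, hence which inequality is
    strict. The strict clauses are conditional because [Q] may leave the domain and [N] the
    range. *)
Definition spectral_split H N Q : Prop :=
  [/\ (\dim N + \dim Q)%N = n,
      forall z, z \in N -> exists2 k, H z k & '[k, z] <= 0,
      forall z k, z \in Q -> H z k -> z != 0 -> 0 < '[k, z],
      forall z, z \in Q -> exists2 h, H h z & 0 <= '[h, z]
    & forall h z, z \in N -> H h z -> z != 0 -> '[h, z] < 0].

Lemma capv_neq0 N Q : (n < \dim N + \dim Q)%N ->
  exists z, [/\ z \in N, z \in Q & z != 0].
Proof.
move=> ltn; exists (vpick (N :&: Q)%VS).
have : (N :&: Q)%VS != 0%VS.
  rewrite -dimv_eq0 -lt0n -(ltn_add2l (\dim (N + Q))%VS) addn0 dimv_sum_cap.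
  apply: leq_ltn_trans ltn; have := dimvS (subvf (N + Q)%VS).
  by rewrite dimvf /dim /= mul1n.
rewrite -vpick0 => ->; have := memv_pick (N :&: Q)%VS.
by rewrite memv_cap => /andP[-> ->].
Qed.

Lemma form_le_dim H1 H2 N1 Q1 N2 Q2 :
  spectral_split H1 N1 Q1 -> spectral_split H2 N2 Q2 -> form_le H1 H2 ->
  (\dim N2 <= \dim N1)%N.
Proof.
case=> dim1 _ pos1 _ _ [_ le2 _ _ _] le12; rewrite leqNgt; apply/negP => lt12.
have [|z [zN zQ z0]] := @capv_neq0 N2 Q1; first by rewrite -{1}dim1 ltn_add2r.
have [k Hzk k_le0] := le2 _ zN; have [k1 Hzk1 le_k] := le12 _ _ Hzk.
have := lt_le_trans (pos1 _ _ zQ Hzk1 z0) (le_trans le_k k_le0).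
by rewrite ltxx.
Qed.

(** At a nonzero [z] in both [N1] and [Q2] the form of [-H2^-1] is nonpositive, while that of
    [-H1^-1] is positive. *)
Lemma form_le_opp_inv_dim H1 H2 N1 Q1 N2 Q2 :
  spectral_split H1 N1 Q1 -> spectral_split H2 N2 Q2 ->
  form_le (opp_rel (inv_rel H1)) (opp_rel (inv_rel H2)) ->
  (\dim N1 <= \dim N2)%N.
Proof.
case=> _ _ _ _ neg1 [dim2 _ _ ge2 _] le12; rewrite leqNgt; apply/negP => lt12.
have [|z [zN zQ z0]] := @capv_neq0 N1 Q2; first by rewrite -{1}dim2 ltn_add2r.
have [h Hhz h_ge0] := ge2 _ zQ.
have [|k1] := le12 z (- h); first by rewrite /opp_rel /inv_rel opprK.
rewrite /opp_rel /inv_rel dotNl => /(neg1 _ _ zN)/(_ z0).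
rewrite dotNl oppr_lt0 => k1_gt0 /(lt_le_trans k1_gt0).
by rewrite oppr_gt0 le_gtF.
Qed.

(** * Ordering of the inverses when the dimensions agree *)

Section EqualIndex.
Variables (H1 H2 : V -> V -> Prop) (N1 Q1 N2 Q2 : {vspace V}).
Hypotheses (sa1 : sa H1) (sa2 : sa H2) (le12 : form_le H1 H2).
Hypotheses (split1 : spectral_split H1 N1 Q1).
Hypotheses (split2 : spectral_split H2 N2 Q2).
Hypothesis dimN : \dim N1 = \dim N2.

(* [N2] has maximal dimension among the nonpositive subspaces of [H1], so
   enlarging it by [u] produces a vector on which the form is positive. *)
Lemma split_maximal u : u \notin N2 ->
  exists v c, [/\ v \in N2, c != 0 &
    forall k, H1 (v + c *: u) k -> 0 < '[k, v + c *: u]].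
Proof.
case: split1 => dim1 _ pos1 _ _; case: split2 => _ le2 _ _ _ uN.
(* [N2] enlarged by [u] has dimension above that of [N1], so it meets [Q1]. *)
have [|z [/memv_addP[v vN [_ /vlineP[c ->] ->]] zQ z0]] := @capv_neq0 (N2 + <[u]>)%VS Q1.
  rewrite -{1}dim1 ltn_add2r dimN (ltn_leqif (dimv_leqif_sup (addvSl _ _))).
  by rewrite subv_add subvv -memvE.
exists v, c; split=> //; last by move=> k Hk; apply: pos1.
(* With [c = 0] the vector would lie in both [N2] and [Q1], where the form of [H1] is nonpositive
   and positive. *)
apply: contra_neq z0 => c0; move: zQ; rewrite c0 scale0r addr0 => vQ.
have [k Hvk k_le0] := le2 _ vN; have [k1 Hvk1 le_k] := le12 Hvk.
apply/eqP; apply: contraT => /(pos1 _ _ vQ Hvk1)/lt_le_trans.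
by move/(_ _ (le_trans le_k k_le0)); rewrite ltxx.
Qed.

(** Adding multiples of [z] to [N2] leaves the form of [H1] unchanged, hence nonpositive, so
    maximality puts [z] in [N2]. There the form of [H2] is squeezed to 0 and [form_le_ker]
    applies. *)
Lemma ker_sub z : H1 z 0 -> H2 z 0.
Proof.
case: split2 => _ le2 _ _ _ Hz.
have zN : z \in N2.
  apply: contraT => /split_maximal[v [c [vN _ pos]]].
  have [k Hvk k_le0] := le2 _ vN; have [k1 Hvk1 le_k] := le12 Hvk.
  have := pos _ (sa_add sa1 Hvk1 (sa_scale c sa1 Hz)).
  rewrite scaler0 addr0 dotDr dotZr (sa_sym sa1 Hz Hvk1) dot0r mulr0 addr0.
  by move=> /lt_le_trans/(_ (le_trans le_k k_le0)); rewrite ltxx.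
have [k Hzk k_le0] := le2 _ zN; have [k1 Hzk1 le_k] := le12 Hzk.
apply: (form_le_ker sa1 sa2 le12 Hz Hzk).
apply/eqP; rewrite eq_le k_le0 /=; apply: le_trans le_k.
by rewrite (sa_sym sa1 Hz Hzk1) dot0r.
Qed.

(* With [u = h1 - h2], duality bounds the form of [H1] at [u + v], for [v] in
   [N2], by [(h1, k) - (h2, k)] plus a nonpositive term. *)
Lemma inv_form_le h1 h2 k : H1 h1 k -> H2 h2 k -> '[h2, k] <= '[h1, k].
Proof.
case: split2 => _ le2 _ _ _ Hh1 Hh2.
rewrite -(sa_sym sa1 Hh1 Hh1) -(sa_sym sa2 Hh2 Hh2).
rewrite real_leNgt ?(sa_form_real sa1 Hh1) ?(sa_form_real sa2 Hh2) //.
rewrite -subr_lt0; apply/negP => lt_h.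
have neg_u v : v \in N2 ->
    exists2 u', H1 (h1 - h2 + v) u' & '[u', h1 - h2 + v] < 0.
  move=> /le2[v' Hv v'_le0].
  have [u' Hu le_u] := form_le_dual sa1 sa2 le12 Hh1 Hh2 Hv.
  by exists u' => //; apply: le_lt_trans le_u _; rewrite ltr_wnDr.
(* If [h1 - h2] is in [N2], taking [v] as its opposite makes the form negative at the zero
   vector. *)
have [uN|/split_maximal[v [c [vN c0 pos]]]] := boolP (h1 - h2 \in N2).
  have [|u' _] := neg_u (- (h1 - h2)); first by rewrite rpredN.
  by rewrite subrr dot0r ltxx.
(* Here [v + c u = c (u + c^-1 v)], so scaling by [|c|^2 > 0] carries negativity over to the vector
   where the form is positive. *)
have [u' Hu' u'_lt0] := neg_u _ (memvZ c^-1 vN : c^-1 *: v \in N2).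
have := sa_scale c sa1 Hu'; rewrite scalerDr scalerA divff // scale1r addrC.
move=> /pos; rewrite -[v in v + _]scale1r -(divff c0) -scalerA -scalerDr addrC.
rewrite dotZl dotZr mulrA pmulr_rgt0 ?mul_conjC_gt0 //.
by move=> /lt_trans/(_ u'_lt0); rewrite ltxx.
Qed.

Lemma form_le_opp_inv :
  (forall k, (forall z, H1 z 0 -> '[k, z] = 0) -> exists h, H1 h k) ->
  form_le (opp_rel (inv_rel H1)) (opp_rel (inv_rel H2)).
Proof.
move=> ran1 k h; rewrite /opp_rel /inv_rel => Hh.
have [|h1 Hh1] := ran1 k.
  by move=> z /ker_sub Hz; rewrite (sa_sym sa2 Hz Hh) dot0r.
exists (- h1); first by rewrite opprK.
by rewrite dotNl lerNl -dotNl (inv_form_le Hh1 Hh).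
Qed.

End EqualIndex.

(* Duality at [v = 0], where the form of [H1] at [h1 - h2] is nonnegative. *)
Lemma form_le_inv H1 H2 : sa H1 -> sa H2 ->
  (forall h k, H1 h k -> 0 <= '[k, h]) ->
  (forall k, (forall z, H2 z 0 -> '[k, z] = 0) -> exists h, H2 h k) ->
  form_le H1 H2 -> form_le (inv_rel H2) (inv_rel H1).
Proof.
move=> sa1 sa2 pos1 ran2 le12 k h1 Hh1.
(* [form_le_ker] is used with the zero operator, which lies below the nonnegative [H1]: a zero of
   the form of [H1] is in its kernel. *)
have zero_sa : sa (fun (_ : V) k => k = 0).
  move=> h k'; split=> [-> h' _ ->|k0]; first by rewrite dot0l dot0r.
  by apply: dot_eq0; rewrite -(k0 k' 0 erefl) dot0l.
have zero_le : form_le (fun _ k => k = 0) H1.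
  by move=> h k' /pos1; exists 0; rewrite ?dot0l.
have [|h2 Hh2] := ran2 k.
  move=> z Hz; have [z' Hz' z'_le0] := le12 _ _ Hz.
  have z0 : '[z', z] = 0.
    by apply/eqP; rewrite eq_le (pos1 _ _ Hz') andbT -(dot0l z).
  have Hz1 := form_le_ker zero_sa sa1 zero_le erefl Hz' z0.
  by rewrite (sa_sym sa1 Hz1 Hh1) dot0r.
exists h2 => //.
have [u' Hu] := form_le_dual sa1 sa2 le12 Hh1 Hh2 (sa_0 sa2).
rewrite dot0l addr0 => /(le_trans (pos1 _ _ Hu)).
by rewrite subr_ge0 (sa_sym sa1 Hh1 Hh1) (sa_sym sa2 Hh2 Hh2).
Qed.

End Splitting.

(** * From the resolvent ordering to the form ordering *)

Section Bridge.
Variables (R : realType) (n : nat).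
Local Notation C := R[i]%C.
Local Notation V := 'rV[C]_n.
Implicit Types (H : linrel R n) (h k z : V).

Definition graph H : V -> V -> Prop := fun h k => (h, k) \in H.

Lemma selfadjoint_graph H : selfadjoint H -> sa (graph H).
Proof.
move=> saH h k; have E : graph H h k <-> radj H (h, k) by rewrite -saH.
split=> [/E Hhk h' k' /Hhk //|Hhk]; apply/E => -[h' k']; exact: Hhk.
Qed.

Lemma graph_rinv H : graph (rinv H) = inv_rel (graph H).
Proof. by apply/funext => h; apply/funext => k; rewrite /graph mem_rinv. Qed.

Lemma graph_ropp H : graph (ropp H) = opp_rel (graph H).
Proof. by apply/funext => h; apply/funext => k; rewrite /graph mem_ropp. Qed.

Lemma graph_rshift H (c : C) : graph (rshift H c) = shift_rel (graph H) c.
Proof. by apply/funext => h; apply/funext => k; rewrite /graph mem_rshift. Qed.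

Lemma sa_ran H k : sa (graph H) ->
  (forall z, graph H z 0 -> '[k, z] = 0) -> exists h, graph H h k.
Proof.
move=> saH; have [P [s Pu Hs]] := sa_spectral saH.
exact: (diag_ran saH Pu Hs).
Qed.

Lemma sa_bounded H : sa (graph H) ->
  exists m : R, forall h k, graph H h k -> m%:C * '[h, h] <= '[k, h].
Proof.
move=> saH; have [P [s Pu Hs]] := sa_spectral saH.
have [m /complex_realP[r ->] le_m] := diag_bounded saH Pu Hs.
by exists r.
Qed.

(** mul H is orthogonal to dom H, so the operator part is single-valued and any [k] related to [h]
    gives the same form value. *)
Lemma rapp_opart H h k : sa (graph H) -> graph H h k ->
  '[rapp (opart H) h, h] = '[k, h].
Proof.
move=> saH Hhk; have [P [s Pu Hs]] := sa_spectral saH.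
have [k' [l [Hk' Hl]]] := diag_opart saH Pu Hs Hhk.
rewrite (@rapp_eq _ _ _ _ k').
- by rewrite (sa_sym saH Hhk Hk') -(sa_sym saH Hhk Hhk).
- move=> g; rewrite mem_opart => /and3P[H0g _ /mem_rdom[g' Hg]].
  by apply: dot_eq0; rewrite -(sa_sym saH H0g Hg) dot0r.
rewrite mem_opart; apply/and3P; split; first exact: Hk'.
  by apply/mem_rdom; exists k.
by apply/mem_rdom; exists l.
Qed.

(** This trades the extended-real supremum, possibly +oo, for a real bound on the form. *)
Lemma lt_lower_boundP H (x : R) : sa (graph H) ->
  (x%:E < lower_bound H)%E <->
  exists2 m : R, x < m & forall h k, graph H h k -> m%:C * '[h, h] <= '[k, h].
Proof.
move=> saH; split=> [/ereal_sup_gt[_ [m le_m <-]] xm|[m xm le_m]].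
  exists m => [|h k Hhk]; first by rewrite -lte_fin.
  by rewrite -(rapp_opart saH Hhk); apply: le_m; apply/mem_rdom; exists k.
apply: (@lt_le_trans _ _ m%:E); first by rewrite lte_fin.
apply: ereal_sup_ubound; exists m => // h /mem_rdom[k Hhk].
by rewrite (rapp_opart saH Hhk); exact: le_m.
Qed.

Section Resolvent.
Variables (H : linrel R n) (x m : R).
Hypotheses (saH : sa (graph H)) (xm : x < m).
Hypothesis le_m : forall h k, graph H h k -> m%:C * '[h, h] <= '[k, h].
Local Notation A := (graph (rshift H x%:C)).

Lemma resolvent_sa : sa A.
Proof. by rewrite graph_rshift; apply: sa_shift; rewrite ?complex_real. Qed.

Lemma shift_form_ge h k : A h k -> (m - x)%:C * '[h, h] <= '[k, h].
Proof.
rewrite graph_rshift => /le_m; rewrite dotDl dotZl -lerBlDr -mulrBl.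
by rewrite -rmorphB.
Qed.

Lemma shift_form_ge0 h k : A h k -> 0 <= '[k, h].
Proof.
move=> /shift_form_ge; apply: le_trans; apply: mulr_ge0; last exact: dot_ge0.
by rewrite ler0c subr_ge0 ltW.
Qed.

Lemma shift_ker0 h : A h 0 -> h = 0.
Proof.
move=> /shift_form_ge; rewrite dot0l pmulr_rle0 ?ltcR ?subr_gt0 // => h0.
by apply: dot_eq0; apply: le_anti; rewrite h0 dot_ge0.
Qed.

Lemma rapp_resolvent h f : A h f -> rapp (rinv (rshift H x%:C)) f = h.
Proof.
move=> Ahf; apply: rapp_eq => [g|]; last by rewrite mem_rinv.
by rewrite mem_rinv => /shift_ker0.
Qed.

Lemma resolvent_onto f : exists h, A h f.
Proof.
by apply: (sa_ran resolvent_sa) => z /shift_ker0 ->; rewrite dot0r.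
Qed.

End Resolvent.

(** Below both lower bounds the resolvents are everywhere defined operators, so their inequality is
    [form_le] for the inverted shifts; [form_le_inv] passes between these and the shifts. *)
Lemma rel_leP H1 H2 : sa (graph H1) -> sa (graph H2) ->
  rel_le H1 H2 <-> form_le (graph H1) (graph H2).
Proof.
move=> sa1 sa2; split.
  move=> [x]; rewrite lt_min => /andP[/(lt_lower_boundP _ sa1)[m1 xm1 le1]].
  move=> /(lt_lower_boundP _ sa2)[m2 xm2 le2] le12.
  have sA1 := resolvent_sa x sa1; have sA2 := resolvent_sa x sa2.
  apply/(form_le_shift _ _ x%:C); rewrite -!graph_rshift.
  (* Inverting twice gives back the relation by conversion, so the antitonicity is applied to the
     inverses. *)
  apply: (form_le_inv (sa_inv sA2) (sa_inv sA1)).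
  - move=> f h A2h; rewrite -(sa_sym sA2 A2h A2h).
    exact: (shift_form_ge0 xm2 le2 A2h).
  - by move=> h; rewrite -graph_rinv; apply: sa_ran; rewrite graph_rinv; apply: sa_inv.
  move=> f h1 A1h; have [h2 A2h] := resolvent_onto sa2 xm2 le2 f.
  exists h2 => //; have /andP[_] := le12 f.
  by rewrite (rapp_resolvent xm1 le1 A1h) (rapp_resolvent xm2 le2 A2h).
move=> le12.
have [m1 le1] := sa_bounded sa1; have [m2 le2] := sa_bounded sa2.
pose x := Num.min m1 m2 - 1.
have xm1 : x < m1 by rewrite ltrBlDr (@le_lt_trans _ _ m1) ?ltrDl // ge_min lexx.
have xm2 : x < m2 by rewrite ltrBlDr (@le_lt_trans _ _ m2) ?ltrDl // ge_min lexx orbT.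
exists x.
  by rewrite lt_min; apply/andP; split; apply/lt_lower_boundP => //;
    [exists m1|exists m2].
have sA1 := resolvent_sa x sa1; have sA2 := resolvent_sa x sa2.
have leA : form_le (graph (rshift H1 x%:C)) (graph (rshift H2 x%:C)).
  by rewrite !graph_rshift; apply/form_le_shift.
have leI := form_le_inv sA1 sA2 (shift_form_ge0 xm1 le1) (fun k => @sa_ran _ k sA2) leA.
move=> f.
have [h1 A1h] := resolvent_onto sa1 xm1 le1 f.
have [h2 A2h] := resolvent_onto sa2 xm2 le2 f.
rewrite (rapp_resolvent xm1 le1 A1h) (rapp_resolvent xm2 le2 A2h).
have [h2' A2h' le_h] := leI _ _ A1h; move: le_h.
rewrite -(rapp_resolvent xm2 le2 A2h') (rapp_resolvent xm2 le2 A2h) => ->.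
by rewrite andbT -(sa_sym sA2 A2h A2h) (shift_form_ge0 xm2 le2 A2h).
Qed.

End Bridge.

(** * Eigenvalue counts read off the diagonalisation *)

Section Counting.
Variables (R : realType) (n : nat).
Local Notation C := R[i]%C.
Local Notation V := 'rV[C]_n.
Variables (H : linrel R n) (P : 'M[C]_n) (s : 'I_n -> option C).
Hypotheses (saH : sa (graph H)) (Punitary : P \is unitarymx).
Hypothesis Hs : forall i,
  if s i is Some l then l \is Num.real /\ graph H (row i P) (l *: row i P)
  else graph H 0 (row i P).

Lemma dim_eigenspace (c : C) : \dim (rker (rshift H c)) = #|[pred i | s i == Some c]|.
Proof.
rewrite -(dim_coordspace Punitary); congr (\dim _); apply/vspaceP => h.
rewrite mem_rker mem_rshift add0r.
by apply/idP/idP => /(diag_eigenspaceP saH Punitary Hs c h).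
Qed.

Lemma null_countE : null_count H = #|[pred i | s i == Some 0]|.
Proof.
rewrite -dim_eigenspace; congr (\dim _); apply/vspaceP => h.
by rewrite !mem_rker mem_rshift scale0r addr0.
Qed.

Lemma reigenvalueP (c : C) : reigenvalue H c <-> exists i, s i = Some c.
Proof.
split=> [[h h0 Hh] | [i si]]; last first.
  have := Hs i; rewrite si => -[_ Hi]; exists (row i P) => //.
  apply/eqP => Pi0; have := dot_basis Punitary i i.
  by rewrite Pi0 dot0l eqxx => /esym/eqP; rewrite oner_eq0.
have : (0 < \dim (rker (rshift H c)))%N.
  rewrite lt0n dimv_eq0; apply: contra_neq h0 => ker0; apply/eqP.
  by rewrite -memv0 -ker0 mem_rker mem_rshift add0r.
by rewrite dim_eigenspace => /card_gt0P[i /eqP]; exists i.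
Qed.

Lemma neg_eigen_countE :
  neg_eigen_count H = #|[pred i | if s i is Some l then l < 0 else false]|.
Proof.
pose neg i := if s i is Some l then l < 0 else false.
(* The default 0 is taken only at [None], which [neg] excludes. *)
pose ev i : C := odflt 0 (s i).
pose r := undup [seq ev i | i <- enum neg].
have memr c : (c \in r) = (c < 0) && [exists i, s i == Some c].
  rewrite mem_undup; apply/mapP/andP => [[j jneg ->]|[c0 /existsP[i /eqP si]]].
    move: jneg; rewrite mem_enum unfold_in /neg /ev.
    case sj: (s j) => [l|//] l0; split=> //.
    by apply/existsP; exists j; rewrite sj.
  by exists i; rewrite ?mem_enum ?unfold_in /neg /ev si.
rewrite /neg_eigen_count.
have -> : [set l : C | l < 0 /\ reigenvalue H l]%classic = [set` r]%classic.
  apply/seteqP; split=> c /=; rewrite memr.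
    by case=> -> /reigenvalueP[i si]; apply/existsP; exists i; rewrite si.
  move=> /andP[-> /existsP[i /eqP si]]; split=> //.
  by apply/reigenvalueP; exists i.
rewrite -fsbig_seq ?undup_uniq //.
under eq_bigr do rewrite dim_eigenspace -sum1_card.
(* After the exchange, index [i] contributes the number of members of [r] equal to its eigenvalue:
   at most one, as [r] has no duplicates. *)
rewrite (exchange_big_dep xpredT) //= -sum1_card [RHS]big_mkcond /=.
apply: eq_bigr => i _; rewrite sum1_count.
transitivity (nat_of_bool (neg i)); last by rewrite inE -/(neg i); case: (neg i).
have negE : neg i = if s i is Some l then l \in r else false.
  rewrite /neg; case si: (s i) => [l|//]; rewrite memr.
  by case: (l < 0) => //=; apply/esym/existsP; exists i; rewrite si.
rewrite negE (eq_count (a2 := fun c => s i == Some c)); last by move=> c; rewrite inE.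
case: (s i) => [l|]; last exact: count_pred0.
rewrite -(count_uniq_mem l (undup_uniq _)); apply: eq_count => c /=.
by rewrite (inj_eq Some_inj) eq_sym.
Qed.

Lemma nonpos_count : (neg_eigen_count H + null_count H)%N = #|nonpos s|.
Proof.
rewrite neg_eigen_countE null_countE -cardUI.
rewrite [X in (_ + X)%N]eq_card0 ?addn0.
  apply: eq_card => i; rewrite !inE unfold_in /nonpos.
  by case: (s i) => // l; rewrite (inj_eq Some_inj) le_eqVlt orbC.
move=> i; rewrite !inE; case: (s i) => // l.
by rewrite (inj_eq Some_inj); case: eqP => [->|]; rewrite ?ltxx ?andbF.
Qed.

End Counting.

Lemma exists_spectral_split (R : realType) (n : nat) (H : linrel R n) :
  sa (graph H) -> exists N Q : {vspace 'rV[R[i]%C]_n},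
    \dim N = (neg_eigen_count H + null_count H)%N /\
    spectral_split (graph H) N Q.
Proof.
move=> saH; have [P [s Pu Hs]] := sa_spectral saH.
exists (coordspace P (nonpos s)), (coordspace P (predC (nonpos s))).
split; first by rewrite dim_coordspace // (nonpos_count saH Pu Hs).
split.
- by rewrite !dim_coordspace // cardC card_ord.
- exact: nonpos_form.
- exact: pos_form.
- exact: nonneg_inv_form.
- exact: neg_inv_form.
Qed.

Theorem theorem1p3 (R : realType) (n : nat) (H1 H2 : linrel R n)
    (H1_sa : selfadjoint H1) (H2_sa : selfadjoint H2) (H12 : rel_le H1 H2) :
  rel_le (ropp (rinv H1)) (ropp (rinv H2)) <->
  (neg_eigen_count H1 + null_count H1 = neg_eigen_count H2 + null_count H2)%N.
Proof.
have sa1 := selfadjoint_graph H1_sa; have sa2 := selfadjoint_graph H2_sa.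
have le12 : form_le (graph H1) (graph H2) by apply/rel_leP.
have [N1 [Q1 [<- split1]]] := exists_spectral_split sa1.
have [N2 [Q2 [<- split2]]] := exists_spectral_split sa2.
have sa_opp_inv (H : linrel R n) : sa (graph H) -> sa (graph (ropp (rinv H))).
  by move=> saH; rewrite graph_ropp graph_rinv; apply/sa_opp/sa_inv.
rewrite (rel_leP (sa_opp_inv _ sa1) (sa_opp_inv _ sa2)) !graph_ropp !graph_rinv.
split=> [le_inv|dimN].
  apply/eqP; rewrite eqn_leq (form_le_opp_inv_dim split1 split2 le_inv).
  exact: form_le_dim split1 split2 le12.
by apply: (form_le_opp_inv sa1 sa2 le12 split1 split2 dimN) => k; apply: sa_ran.
Qed.
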